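(* Let $k$ be a non-negative integer, $0<\alpha<1$, and let $\Gamma$ be the boundary of a Jordan domain in $\mathbb{R}^m$, $\Gamma$ being a Lyapunov surface. Let $f=\{f^{(j)}:|j|\le k\}\in\mathrm{Lip}(k+\alpha,\Gamma)$ be $\mathbb{R}_{0,m}$-valued such that $f^{(0)}\equiv0$ on $\Gamma$ and, for every $1\le s\le k$, $$\sum_{\substack{|j|=s\\ j_i\ \mathrm{even}}}f^{(j)}=0\ \text{ on }\Gamma\quad\text{if } s \text{ is even},\qquad \sum_{\substack{|j+l|=s\\ j_i\ \mathrm{even},\ |l|=1}}e_{(l)}f^{(j+l)}=0\ \text{ on }\Gamma\quad\text{if } s\text{ is odd}.$$ Then $f\equiv0$, i.e. $f^{(j)}=0$ on $\Gamma$ for all $|j|\le k$.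
   Context: $\mathbb{R}_{0,m}$ ($m\ge2$) is the real Clifford algebra generated by an orthonormal basis $e_1,\dots,e_m$ of $\mathbb{R}^m$ with $e_i^2=-1$, $e_ie_{i'}=-e_{i'}e_i$ for $i\ne i'$. Conditions on $\mathbb{R}_{0,m}$-valued functions are understood componentwise. For a multi-index $l$ with $|l|=1$ and $l_i=1$, $e_{(l)}=e_i$. In the sums, ''$j_i$ even'' means all entries of the multi-index $j=(j_1,\dots,j_m)$ are even; in the odd case the sum runs over pairs $(j,l)$ of multi-indices. A Jordan domain is a bounded oriented connected open subset of $\mathbb{R}^m$ whose boundary is a compact topological surface; the boundary $\Gamma$ is assumed to be a Lyapunov surface (compact hypersurface of class $C^{1,\lambda}$, $0<\lambda\le1$). An element of $\mathrm{Lip}(k+\alpha,\Gamma)$ is a collection $f=\{f^{(j)}:|j|\le k\}$ of functions on $\Gamma$ indexed by multi-indices $j$ such that, with $$R_j(x,y)=f^{(j)}(x)-\sum_{|j+l|\le k}\frac{f^{(j+l)}(y)}{l!}(x-y)^l,$$ there is $M>0$ with $|f^{(j)}(x)|\le M$ and $|R_j(x,y)|\le M|x-y|^{k+\alpha-|j|}$ for all $x,y\in\Gamma$, $|j|\le k$. *)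

(* Defs.v *)
From HB Require Import structures.
From mathcomp Require Import all_boot all_order all_algebra.
From mathcomp Require Import all_classical all_reals all_analysis.
From mathcomp Require Import ring.
From mathcomp Require Import -(notations) mpoly.

Set Implicit Arguments.
Unset Strict Implicit.
Unset Printing Implicit Defensive.

Import Order.TTheory GRing.Theory Num.Theory numFieldNormedType.Exports.
Local Open Scope ring_scope.

Section SymmetricDifference.
Variable T : finType.
Implicit Types A B C : {set T}.

Definition symdiff A B : {set T} := [set i | (i \in A) (+) (i \in B)].

Lemma in_symdiff A B i : (i \in symdiff A B) = (i \in A) (+) (i \in B).
Proof. by rewrite inE. Qed.

Lemma symdiffA : associative symdiff.
Proof. by move=> A B C; apply/setP=> i; rewrite !in_symdiff addbA. Qed.

Lemma symdiffC : commutative symdiff.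
Proof. by move=> A B; apply/setP=> i; rewrite !in_symdiff addbC. Qed.

Lemma symdiff0s : left_id finset.set0 symdiff.
Proof. by move=> A; apply/setP=> i; rewrite in_symdiff inE. Qed.

Lemma symdiffss A : symdiff A A = finset.set0.
Proof. by apply/setP=> i; rewrite in_symdiff inE addbb. Qed.

Lemma symdiffK A : involutive (symdiff A).
Proof. by move=> B; rewrite symdiffA symdiffss symdiff0s. Qed.

Lemma symdiffs0 : right_id finset.set0 symdiff.
Proof. by move=> A; rewrite symdiffC symdiff0s. Qed.

End SymmetricDifference.

(* The real Clifford algebra R_{0,m}: an element is the family of its          *)
(* coordinates in the basis e_A = e_{i_1} ... e_{i_h}, where                   *)
(* A = {i_1 < ... < i_h} is a subset of 'I_m. This is a record rather than an  *)
(* alias because {ffun {set 'I_m} -> R} already carries the pointwise product. *)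
Record clifford (R : comNzRingType) (m : nat) : Type :=
  Clifford { cl_coord :> {ffun {set 'I_m} -> R} }.

HB.instance Definition _ (R : comNzRingType) m :=
  [isNew for @cl_coord R m].
HB.instance Definition _ (R : comNzRingType) m :=
  [Choice of clifford R m by <:].

Section CliffordAlgebra.
Variables (R : comNzRingType) (m : nat).
Implicit Types (a b c : clifford R m) (A B C D : {set 'I_m}) (i j : 'I_m).

Definition cl_of (F : {set 'I_m} -> R) : clifford R m :=
  Clifford (finfun F).

Lemma cl_ofE F A : cl_of F A = F A.
Proof. by rewrite ffunE. Qed.

Lemma cliffordP a b : (forall A, a A = b A) <-> a = b.
Proof.
by split=> [eq_ab|->//]; apply: val_inj; apply/ffunP=> A; exact: eq_ab.
Qed.

Definition cl_zero : clifford R m := cl_of (fun=> 0).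
Definition cl_opp a : clifford R m := cl_of (fun A => - a A).
Definition cl_add a b : clifford R m := cl_of (fun A => a A + b A).
Definition cl_scale (x : R) a : clifford R m := cl_of (fun A => x * a A).

Fact cl_addA : associative cl_add.
Proof. by move=> a b c; apply/cliffordP=> A; rewrite !cl_ofE addrA. Qed.
Fact cl_addC : commutative cl_add.
Proof. by move=> a b; apply/cliffordP=> A; rewrite !cl_ofE addrC. Qed.
Fact cl_add0 : left_id cl_zero cl_add.
Proof. by move=> a; apply/cliffordP=> A; rewrite !cl_ofE add0r. Qed.
Fact cl_addN : left_inverse cl_zero cl_opp cl_add.
Proof. by move=> a; apply/cliffordP=> A; rewrite !cl_ofE addNr. Qed.

HB.instance Definition _ :=
  GRing.isZmodule.Build (clifford R m) cl_addA cl_addC cl_add0 cl_addN.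

Lemma cl_coord0 A : (0 : clifford R m) A = 0.
Proof. exact: cl_ofE. Qed.
Lemma cl_coordN a A : (- a) A = - a A.
Proof. exact: cl_ofE. Qed.
Lemma cl_coordD a b A : (a + b) A = a A + b A.
Proof. exact: cl_ofE. Qed.
Lemma cl_coord_sum I (r : seq I) (P : pred I) (F : I -> clifford R m) A :
  (\sum_(x <- r | P x) F x) A = \sum_(x <- r | P x) F x A.
Proof.
by apply: (big_morph (fun a : clifford R m => a A)) => [a b|];
  rewrite ?cl_coordD ?cl_coord0.
Qed.

(* e_A e_B = (-1)^(cl_swaps A B) e_(symdiff A B): sorting the concatenated     *)
(* word takes one anticommutation for each pair with b < a, and the factors    *)
(* with b = a then cancel with e_a^2 = -1.                                     *)
Definition cl_swaps A B : nat :=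
  (\sum_(i in A) \sum_(j in B) (j <= i))%N.

Definition cl_sign A B : R := (-1) ^+ cl_swaps A B.

Lemma cl_signE A B :
  cl_sign A B = \prod_(i in A) \prod_(j in B) (-1) ^+ (j <= i)%N.
Proof.
rewrite /cl_sign /cl_swaps -prodrXr; apply: eq_bigr => i _.
by rewrite -prodrXr.
Qed.

Lemma prod_symdiff (F : 'I_m -> R) A B : (forall i, F i * F i = 1) ->
  \prod_(i in symdiff A B) F i = (\prod_(i in A) F i) * \prod_(i in B) F i.
Proof.
move=> FF; rewrite [LHS]big_mkcond [X in _ = X * _]big_mkcond.
rewrite [X in _ = _ * X]big_mkcond -big_split; apply: eq_bigr => i _ /=.
by rewrite in_symdiff; case: (i \in A); case: (i \in B);
  rewrite /= ?FF ?mulr1 ?mul1r.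
Qed.

Lemma cl_signDl A B C :
  cl_sign (symdiff A B) C = cl_sign A C * cl_sign B C.
Proof.
rewrite !cl_signE prod_symdiff // => i.
rewrite /= -big_split big1 //= => j _.
by rewrite -expr2 sqrr_sign.
Qed.

Lemma cl_signDr A B C :
  cl_sign A (symdiff B C) = cl_sign A B * cl_sign A C.
Proof.
rewrite !cl_signE -big_split /=; apply: eq_bigr => i _.
by apply: prod_symdiff => j; rewrite -expr2 sqrr_sign.
Qed.

Lemma cl_sign0s A : cl_sign finset.set0 A = 1.
Proof. by rewrite cl_signE big_set0. Qed.

Lemma cl_signs0 A : cl_sign A finset.set0 = 1.
Proof. by rewrite cl_signE big1 // => i _; rewrite big_set0. Qed.

Definition cl_basis A : clifford R m := cl_of (fun B => (B == A)%:R).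

Definition cl_one : clifford R m := cl_basis finset.set0.

Definition cl_mul a b : clifford R m :=
  cl_of (fun C => \sum_A cl_sign A (symdiff A C) * a A * b (symdiff A C)).

Fact cl_mulA : associative cl_mul.
Proof.
move=> a b c; apply/cliffordP=> D; rewrite !cl_ofE; symmetry.
under eq_bigr => E _ do rewrite cl_ofE mulr_sumr mulr_suml.
rewrite exchange_big /=; apply: eq_bigr => A _.
rewrite cl_ofE mulr_sumr (reindex_inj (can_inj (symdiffK A))) /=.
apply: eq_bigr => B _; rewrite symdiffK.
have -> : symdiff (symdiff A B) D = symdiff B (symdiff A D).
  by rewrite symdiffA (symdiffC B).
rewrite !cl_signDl.
set C := symdiff B (symdiff A D).
have -> : symdiff A D = symdiff B C by rewrite symdiffK.
rewrite cl_signDr.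
set x := cl_sign A C; set y := cl_sign B C; set z := cl_sign A B.
by ring.
Qed.

Fact cl_mul1l : left_id cl_one cl_mul.
Proof.
move=> a; apply/cliffordP=> C; rewrite cl_ofE (bigD1 finset.set0) //= big1.
  by rewrite cl_ofE eqxx symdiff0s cl_sign0s addr0 !mul1r.
by move=> A /negPf A0; rewrite cl_ofE A0 mulr0 mul0r.
Qed.

Fact cl_mul1r : right_id cl_one cl_mul.
Proof.
move=> a; apply/cliffordP=> C; rewrite cl_ofE (bigD1 C) //= big1.
  by rewrite symdiffss cl_ofE eqxx cl_signs0 addr0 mul1r mulr1.
move=> A AC; rewrite cl_ofE (_ : _ == _ = false) ?mulr0 //.
apply: contraNF AC => /eqP AC0.
by rewrite -[C](symdiffK A) AC0 symdiffs0.
Qed.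

Fact cl_mulDl : left_distributive cl_mul +%R.
Proof.
move=> a b c; apply/cliffordP=> C; rewrite cl_coordD !cl_ofE -big_split /=.
by apply: eq_bigr => A _; rewrite cl_coordD mulrDr mulrDl.
Qed.

Fact cl_mulDr : right_distributive cl_mul +%R.
Proof.
move=> a b c; apply/cliffordP=> C; rewrite cl_coordD !cl_ofE -big_split /=.
by apply: eq_bigr => A _; rewrite cl_coordD mulrDr.
Qed.

Fact cl_one_neq0 : cl_one != 0.
Proof.
apply/eqP => /cliffordP/(_ finset.set0)/eqP.
by rewrite cl_coord0 cl_ofE eqxx oner_eq0.
Qed.

HB.instance Definition _ := GRing.Zmodule_isNzRing.Build (clifford R m)
  cl_mulA cl_mul1l cl_mul1r cl_mulDl cl_mulDr cl_one_neq0.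

Fact cl_scaleA (x y : R) a : cl_scale x (cl_scale y a) = cl_scale (x * y) a.
Proof. by apply/cliffordP=> A; rewrite !cl_ofE mulrA. Qed.
Fact cl_scale1 : left_id 1 cl_scale.
Proof. by move=> a; apply/cliffordP=> A; rewrite cl_ofE mul1r. Qed.
Fact cl_scaleDr : right_distributive cl_scale +%R.
Proof.
by move=> x a b; apply/cliffordP=> A; rewrite !(cl_ofE, cl_coordD) mulrDr.
Qed.
Fact cl_scaleDl a : {morph cl_scale^~ a : x y / x + y}.
Proof.
by move=> x y; apply/cliffordP=> A; rewrite !(cl_ofE, cl_coordD) mulrDl.
Qed.

HB.instance Definition _ := GRing.Zmodule_isLmodule.Build R (clifford R m)
  cl_scaleA cl_scale1 cl_scaleDr cl_scaleDl.

Lemma cl_coordZ x a A : (x *: a) A = x * a A.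
Proof. exact: cl_ofE. Qed.

Fact cl_scaleAl (x : R) a b : x *: (a * b) = (x *: a) * b.
Proof.
apply/cliffordP=> C; rewrite cl_coordZ !cl_ofE mulr_sumr.
by apply: eq_bigr => A _; rewrite ?cl_coordZ; ring.
Qed.

HB.instance Definition _ :=
  GRing.Lmodule_isLalgebra.Build R (clifford R m) cl_scaleAl.

Fact cl_scaleAr (x : R) a b : x *: (a * b) = a * (x *: b).
Proof.
apply/cliffordP=> C; rewrite cl_coordZ !cl_ofE mulr_sumr.
by apply: eq_bigr => A _; rewrite ?cl_coordZ; ring.
Qed.

HB.instance Definition _ :=
  GRing.Lalgebra_isAlgebra.Build R (clifford R m) cl_scaleAr.

Lemma cl_basisM A B :
  cl_basis A * cl_basis B = cl_sign A B *: cl_basis (symdiff A B).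
Proof.
apply/cliffordP=> C; rewrite cl_coordZ !cl_ofE (bigD1 A) //= big1 ?addr0.
  rewrite !cl_ofE eqxx mulr1; case: (eqVneq C (symdiff A B)) => [->|CAB].
    by rewrite symdiffK eqxx.
  rewrite (_ : _ == B = false) ?mulr0 //.
  by apply: contraNF CAB => /eqP <-; rewrite symdiffK.
by move=> D /negPf DA; rewrite cl_ofE DA mulr0 mul0r.
Qed.

Lemma cl_basis_sum a : a = \sum_A a A *: cl_basis A.
Proof.
apply/cliffordP=> B; rewrite cl_coord_sum (bigD1 B) // big1 ?addr0.
  by rewrite cl_coordZ cl_ofE eqxx mulr1 /= addr0.
by move=> A /andP[_ /negPf AB]; rewrite cl_coordZ cl_ofE eq_sym AB mulr0.
Qed.

Definition cl_gen i : clifford R m := cl_basis [set i]%SET.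

Lemma cl_sign11 i j : cl_sign [set i]%SET [set j]%SET = (-1) ^+ (j <= i)%N.
Proof. by rewrite cl_signE !big_set1. Qed.

Lemma cl_gen_sqr i : cl_gen i * cl_gen i = -1.
Proof.
by rewrite cl_basisM cl_sign11 leqnn symdiffss expr1 scaleN1r.
Qed.

Lemma cl_genC i j : i != j -> cl_gen i * cl_gen j = - (cl_gen j * cl_gen i).
Proof.
move=> ij; rewrite !cl_basisM !cl_sign11 symdiffC -scaleNr.
congr (_ *: _); move: ij; rewrite -val_eqE /=.
by case: (ltngtP i j) => //; rewrite ?expr0 ?expr1 ?opprK.
Qed.

(* The ordered products of generators are the basis, so that clifford R m is   *)
(* generated by the e_i and has dimension 2^m.                                 *)
Lemma cl_basis_prod A : cl_basis A = \prod_(i < m | i \in A) cl_gen i.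
Proof.
have srt : sorted (fun i j : 'I_m => i < j)%N (index_enum 'I_m).
  have: sorted ltn (map val (enum 'I_m)) by rewrite val_enum_ord iota_ltn_sorted.
  by rewrite sorted_map -[index_enum _]/(Finite.enum _) -enumT.
suff H s : sorted (fun i j : 'I_m => i < j)%N s ->
    \prod_(i <- s | i \in A) cl_gen i = cl_basis [set i in s | i \in A]%SET.
  rewrite H //; congr cl_basis; apply/setP=> i.
  by rewrite inE mem_index_enum.
elim: s => [_|i s IHs /= /[dup] pis /path_sorted /IHs {}IHs].
  by rewrite big_nil; congr cl_basis; apply/setP=> i; rewrite !inE.
have lt_is j : j \in s -> (i < j)%N.
  by move: pis => /(order_path_min (fun _ _ _ => @ltn_trans _ _ _))/allP; apply.
rewrite big_cons IHs; case: ifP => iA; last first.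
  congr cl_basis; apply/setP=> j; rewrite !inE.
  by case: eqVneq => [->|//]; rewrite iA !andbF.
rewrite cl_basisM (_ : cl_sign _ _ = 1) ?scale1r.
  congr cl_basis; apply/setP=> j; rewrite !inE.
  case: eqVneq => [->|_ //]; rewrite iA andbT.
  by case: (boolP (i \in s)) => // /lt_is; rewrite ltnn.
rewrite cl_signE big_set1 big1 // => j; rewrite inE => /andP[/lt_is ij _].
by rewrite leqNgt ij.
Qed.

End CliffordAlgebra.

Section MultiIndices.
Variable m : nat.
Implicit Types j l : multinom m.

Definition mi_even j : bool := [forall i, ~~ odd (j i)].

Definition mi_fact l : nat := (\prod_(i < m) (l i)`!)%N.

(* e_(l) = e_i when |l| = 1 and l_i = 1; junk value 0 if no entry of l is 1. *)
Definition cl_mi (R : comNzRingType) l : clifford R m :=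
  if [pick i | l i == 1%N] is Some i then cl_gen R i else 0.

End MultiIndices.

Section Geometry.
Variables (R : realType) (m : nat).
Local Open Scope classical_set_scope.

(* The library norm on 'rV[R]_m is the sup norm. *)
Definition enorm (x : 'rV[R]_m) : R := Num.sqrt (\sum_(i < m) x ord0 i ^+ 2).

Definition boundary (A : set 'rV[R]_m) : set 'rV[R]_m :=
  closure A `\` interior A.

(* g parametrizes S inside U by the open set V of R^(m-1), with inverse h. *)
Definition local_param (S U : set 'rV[R]_m) (V : set 'rV[R]_m.-1)
    (g : 'rV[R]_m.-1 -> 'rV[R]_m) (h : 'rV[R]_m -> 'rV[R]_m.-1) : Prop :=
  [/\ open U /\ open V,
      set_bij V (S `&` U) g,
      (forall v, V v -> h (g v) = v),
      {within V, continuous g} &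
      {within S `&` U, continuous h}].

Definition topological_surface (S : set 'rV[R]_m) : Prop :=
  forall p, S p -> exists U V g h, U p /\ local_param S U V g h.

Definition C1_immersion (lam : R) (V : set 'rV[R]_m.-1)
    (g : 'rV[R]_m.-1 -> 'rV[R]_m) : Prop :=
  (forall v, V v -> differentiable g v /\ row_free ('J g v)) /\
  exists H : R, forall u v, V u -> V v ->
    `|'J g u - 'J g v| <= H * `|u - v| `^ lam.

(* Since the parametrizations are local, the Hoelder constant of the           *)
(* differential may depend on the patch.                                       *)
Definition lyapunov_surface (lam : R) (S : set 'rV[R]_m) : Prop :=
  compact S /\
  forall p, S p ->
    exists U V g h, [/\ U p, local_param S U V g h & C1_immersion lam V g].

(* An open subset of R^m carries the orientation of R^m, so "oriented" is no   *)
(* further condition.                                                          *)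
Definition jordan_domain (Omega : set 'rV[R]_m) : Prop :=
  [/\ bounded_set Omega, open Omega, connected Omega,
      compact (boundary Omega) & topological_surface (boundary Omega)].

End Geometry.

Section Lipschitz.
Variables (R : realType) (m : nat).

(* A collection {f^(j) : |j| <= k} is a family indexed by all multi-indices,   *)
(* of which only the members with |j| <= k are ever used. The index type       *)
(* bmultinom m k.+1 of a sum is the finite type of multi-indices with          *)
(* |l| <= k.                                                                   *)
Definition jet_remainder (k : nat) (f : multinom m -> 'rV[R]_m -> R)
    (j : multinom m) (x y : 'rV[R]_m) : R :=
  f j x - \sum_(l : bmultinom m k.+1 | (mdeg (mnm_add j l) <= k)%N)
    f (mnm_add j l) y / (mi_fact l)%:R * mmap1 (fun i => (x - y) ord0 i) l.

Definition Lip (k : nat) (alpha : R) (S : set 'rV[R]_m)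
    (f : multinom m -> 'rV[R]_m -> R) : Prop :=
  exists2 M : R, 0 < M &
    forall j : multinom m, (mdeg j <= k)%N -> forall x y, S x -> S y ->
      `|f j x| <= M /\
      `|jet_remainder k f j x y|
        <= M * enorm (x - y) `^ (k%:R + alpha - (mdeg j)%:R).

Definition cl_Lip (k : nat) (alpha : R) (S : set 'rV[R]_m)
    (f : multinom m -> 'rV[R]_m -> clifford R m) : Prop :=
  forall A : {set 'I_m}, Lip k alpha S (fun j x => f j x A).

End Lipschitz.

(* Main.v *)
Require Import Defs.
From mathcomp Require Import all_boot all_order all_algebra.
From mathcomp Require Import all_classical all_reals all_analysis.
From mathcomp Require Import -(notations) mpoly.
From mathcomp Require Import lra.
Import Order.TTheory GRing.Theory Num.Theory numFieldNormedType.Exports.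
Local Open Scope ring_scope.

Set Implicit Arguments.
Unset Strict Implicit.

(* Induction on the order s: suppose that the members of order s vanish on     *)
(* Gamma. Dividing the remainder R_j(x, y), |j| = s, by |x - y| and letting x  *)
(* tend to y along Gamma shows that sum_i f^(j + e_i)(y) t_i = 0 for every     *)
(* tangent vector t at y. So f^(j + e_i)(y) is proportional to the i-th        *)
(* coordinate of a normal vector nu, and by symmetry of the indices            *)
(* f^(j)(y) = nu^j c for all |j| = s + 1, with c independent of j. The         *)
(* hypothesis at y then reads P c = 0 (s + 1 even) or P nu c = 0 (s + 1 odd),  *)
(* where P = sum nu^j over even j is a positive real and nu, seen as a         *)
(* Clifford vector, is invertible because nu^2 = - |nu|^2. Hence c = 0.        *)

(** In the inductive step outlined above, [jet_linear_part_le] bounds the linear part of the jet by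
    a multiple of |x - y|^(1 + alpha), and [tangent_annihilated] concludes that it vanishes on the
    image of the differential of a parametrization. This image is a hyperplane, so its annihilator
    is a line ([row_free_normal]), and [normal_derivatives] scales a generator nu so that nu_p = 1.
    Then c is the member of f at the pure index (s + 1) e_p ([homogeneous_monomial]). The hypothesis
    of order s + 1 becomes one equation for c, solved in [even_sum_monomial_eq0] and
    [odd_sum_monomial_eq0]. *)

Lemma sum_mdeg1 (V : nmodType) n b (F : multinom n -> V) : (1 < b)%N ->
  \sum_(l : bmultinom n b | mdeg l == 1%N) F l = \sum_(i < n) F (mnm1 i).
Proof.
move=> b1; have mdeg1_lt i : (mdeg (@mnm1 n i) < b)%N by rewrite mdeg1.
pose h i := BMultinom (mdeg1_lt i).
have himg : [set l : bmultinom n b | mdeg l == 1%N]%SET =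
    [set h i | i : 'I_n]%SET.
  apply/setP => l; rewrite inE; apply/mdeg1P/imsetP => [[i /eqP li]|[i _ ->]].
    by exists i => //; apply/val_inj.
  by exists i.
rewrite -big_set himg big_imset //= => i j _ _ hij.
by apply/eqP; rewrite -eq_mnm1; have /= -> := congr1 (@bmnm n b) hij.
Qed.

(** Monomials with even exponents are nonnegative, and the index s e_p, even because s is,
    contributes nu_p^s = 1. *)
Lemma mmap1_even_sum_gt0 (R : realDomainType) n (nu : 'I_n -> R) p s b :
  nu p = 1 -> ~~ odd s -> (s < b)%N ->
  0 < \sum_(j : bmultinom n b | (mdeg j == s) && mi_even j) mmap1 nu j.
Proof.
move=> nup evs sb.
have mdeg_ps : mdeg (mnm_muln (mnm1 p) s) = s by rewrite mdegMn mdeg1 mul1n.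
have lt_b : (mdeg (mnm_muln (mnm1 p) s) < b)%N by rewrite mdeg_ps.
rewrite (bigD1 (BMultinom lt_b)) /=; last first.
  rewrite mdeg_ps eqxx; apply/forallP => i; rewrite mulmnE mnm1E.
  by case: eqP; rewrite ?mul1n ?mul0n.
rewrite ltr_wpDr //; first apply: sumr_ge0 => j /andP[/andP[_ /forallP evj] _].
  apply: prodr_ge0 => i _; exact: exprn_even_ge0.
rewrite [mmap1 _ _](_ : _ = 1) // /mmap1 big1 // => i _.
rewrite mulmnE mnm1E; case: eqP => [<-|_]; last by rewrite mul0n expr0.
by rewrite nup expr1n.
Qed.

(** A Clifford vector v satisfies v^2 = -|nu|^2, a nonzero scalar here. Adding to the double sum for
    v^2 its transpose cancels the off-diagonal terms by anticommutation, hence the doubled square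
    [v * v + v * v]. *)
Lemma cl_vec_reg (R : realDomainType) m (nu : 'I_m -> R) p (c : clifford R m) :
  nu p != 0 -> (\sum_i nu i *: cl_gen R i) * c = 0 -> c = 0.
Proof.
set v := \sum_i _ => nup vc0.
have vv : v * v + v * v = - (\sum_i nu i ^+ 2 *+ 2)%:A.
  have vvE : v * v = \sum_i \sum_j (nu i * nu j) *: (cl_gen R i * cl_gen R j).
    rewrite mulr_suml; apply: eq_bigr => i _; rewrite mulr_sumr.
    by apply: eq_bigr => j _; rewrite -scalerAl -scalerAr scalerA.
  rewrite {1}vvE exchange_big vvE -big_split /= scaler_suml -sumrN.
  apply: eq_bigr => i _; rewrite -big_split /= (bigD1 i) //= big1 => [|j ji].
    by rewrite cl_gen_sqr addr0 -expr2 scalerN -opprD -scalerDl -mulr2n.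
  by rewrite mulrC cl_genC // scalerN addNr.
have : (v * v + v * v) * c = 0 by rewrite mulrDl -mulrA vc0 mulr0 addr0.
rewrite vv mulNr -scalerAl mul1r => /eqP; rewrite oppr_eq0 => /eqP c0.
apply/cliffordP => A; have /cliffordP/(_ A)/eqP := c0.
rewrite cl_coordZ cl_coord0 mulf_eq0 => /orP[|/eqP//].
suff S0 : 0 < \sum_i nu i ^+ 2 *+ 2 by rewrite (gt_eqF S0).
rewrite (bigD1 p) //= ltr_wpDr //.
  by apply: sumr_ge0 => i _; rewrite mulrn_wge0 ?sqr_ge0.
by rewrite pmulrn_lgt0 // exprn_even_gt0.
Qed.

(** * The normal line and the resulting monomial form *)

(** The rank of [J] is m - 1, so its annihilator is a line. Dividing a generator by a nonzero entry
    p makes the factor of proportionality of [a] equal to its own p-th entry. *)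
Lemma row_free_normal (F : fieldType) m (J : 'M[F]_(m.-1, m)) :
  (0 < m)%N -> row_free J ->
  exists (nu : 'rV[F]_m) (p : 'I_m), nu ord0 p = 1 /\
    forall a : 'rV[F]_m, J *m a^T = 0 ->
      forall i, a ord0 i = nu ord0 i * a ord0 p.
Proof.
move=> m0 /eqP rJ; set K := kermx J^T.
have rK : \rank K = 1%N.
  by rewrite mxrank_ker mxrank_tr rJ -subn1 subKn.
have nK : nz_row K != 0 by rewrite nz_row_eq0 -mxrank_eq0 rK.
have Kn : (K <= nz_row K)%MS.
  by rewrite -(geq_leqif (mxrank_leqif_sup (nz_row_sub K))) rK rank_rV nK.
have [p nup] : exists p, nz_row K ord0 p != 0.
  by move/rV0Pn: nK.
exists ((nz_row K ord0 p)^-1 *: nz_row K), p; split=> [|a aJ i].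
  by rewrite mxE mulVf.
have /submx_trans/(_ Kn) : (a <= K)%MS.
  by apply/sub_kermxP; rewrite -[a]trmxK -trmx_mul aJ trmx0.
case/sub_rVP => c ->; rewrite !mxE.
by rewrite mulrCA (mulrC _^-1) divfK // mulrC.
Qed.

(** Each unit of an index in direction i can be traded for one in direction p at the price of a
    factor nu_i; trading all of them leaves s e_p. *)
Lemma homogeneous_monomial (R : comNzRingType) n (V : lmodType R)
    (nu : 'I_n -> R) p (F : multinom n -> V) s :
  (forall j i, (mdeg j).+1 = s ->
     F (mnm_add j (mnm1 i)) = nu i *: F (mnm_add j (mnm1 p))) ->
  forall j, mdeg j = s -> F j = mmap1 nu j *: F (mnm_muln (mnm1 p) s).
Proof.
move=> HF.
(* Here [t] counts the units already traded and [d] those still to be traded. *)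
have H d j t : mdeg j = d -> (d + t)%N = s ->
    F (mnm_add j (mnm_muln (mnm1 p) t)) = mmap1 nu j *: F (mnm_muln (mnm1 p) s).
  elim: d j t => [|d IH] j t dj dts.
    move/eqP: dj; rewrite mdeg_eq0 => /eqP ->.
    by rewrite add0m mmap11 scale1r -dts.
  have [i ji] : exists i, j i != 0%N.
    apply/existsP; rewrite -negb_forall; apply/negP => /forallP j0.
    by move: dj; rewrite mdegE big1 // => i _; apply/eqP.
  have jE : mnm_add (mnm_sub j (mnm1 i)) (mnm1 i) = j.
    by apply: submK; rewrite lep1mP.
  have dj' : mdeg (mnm_sub j (mnm1 i)) = d.
    by move: dj; rewrite -{1}jE mdegD mdeg1 addn1 => -[].
  rewrite -jE commr_mmap1_M; last by move=> *; exact: mulrC.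
  rewrite mmap1U -addmA (addmC (mnm1 i)) addmA HF; last first.
    by rewrite mdegD dj' mdegMn mdeg1 mul1n -addSn.
  by rewrite -addmA -mulmSr IH ?addnS// scalerA mulrC.
by move=> j dj; rewrite -(H s j 0%N) ?addn0// mulm0n addm0.
Qed.

(** * Estimate of the linear part of the jet *)

Lemma le_coord_norm (R : realType) m (z : 'rV[R]_m) i : `|z ord0 i| <= `|z|.
Proof.
rewrite [leRHS]mx_normrE.
exact: (le_bigmax _ (fun ij : 'I_1 * 'I_m => `|z ij.1 ij.2|) (ord0, i)).
Qed.

Lemma enorm_le (R : realType) m (z : 'rV[R]_m) : enorm z <= m%:R * `|z|.
Proof.
rewrite -[leRHS]ger0_norm ?mulr_ge0// -sqrtr_sqr ler_sqrt ?sqr_ge0//.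
apply: (@le_trans _ _ (\sum_(i < m) `|z| ^+ 2)).
  apply: ler_sum => i _; rewrite -real_normK ?num_real// lerXn2r ?nnegrE//.
  exact: le_coord_norm.
rewrite sumr_const card_ord -[leLHS]mulr_natl exprMn ler_wpM2r ?sqr_ge0//.
by rewrite -natrX ler_nat; case: (m) => // n; rewrite leq_pmulr.
Qed.

Lemma powR_le_exp (R : realType) (a x y : R) :
  0 <= a <= 1 -> 0 < y <= x -> a `^ x <= a `^ y.
Proof.
move=> /andP[]; rewrite le_eqVlt => /predU1P[<- _|a0 a1] /andP[y0 yx].
  by rewrite !powR0 ?gt_eqF// (lt_le_trans y0 yx).
by apply: ger_powR; rewrite ?a0.
Qed.

Lemma mi_fact1 n i : mi_fact (@mnm1 n i) = 1%N.
Proof. by rewrite /mi_fact big1 // => l _; rewrite mnm1E; case: eqP. Qed.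

Lemma mmap1_norm_le (R : realType) m (z : 'rV[R]_m) (l : multinom m) :
  `|mmap1 (fun i => z ord0 i) l| <= `|z| ^+ mdeg l.
Proof.
rewrite /mmap1 normr_prod mdegE -prodrXr; apply: ler_prod => i _.
by rewrite normr_ge0 normrX lerXn2r ?nnegrE// le_coord_norm.
Qed.

(** As f^(j) vanishes on [S], the remainder is, up to sign, the linear part plus the terms with |l|
    >= 2. The latter are O(|x - y|^2), and the remainder is O(|x - y|^p) with p = k + alpha - |j| >=
    1 + alpha. For |x - y| <= 1 both are O(|x - y|^(1 + alpha)). *)
Lemma jet_linear_part_le (R : realType) m k (alpha : R) (S : set 'rV[R]_m)
    (f : multinom m -> 'rV[R]_m -> R) (j : multinom m) (y : 'rV[R]_m) :
  0 < alpha <= 1 -> Lip k alpha S f -> (mdeg j < k)%N ->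
  (forall x, S x -> f j x = 0) -> S y ->
  exists C : R, forall x, S x -> `|x - y| <= 1 ->
    `|\sum_i f (mnm_add j (mnm1 i)) y * (x - y) ord0 i|
      <= C * `|x - y| `^ (1 + alpha).
Proof.
move=> /andP[a0 a1] [M M0 HM] jk fj0 Sy.
set p := k%:R + alpha - (mdeg j)%:R.
have p1 : 1 + alpha <= p.
  by rewrite /p addrAC lerD2r -natrB ?(ltnW jk)// ler1n subn_gt0.
pose K := \sum_(l : bmultinom m k.+1) `|f (mnm_add j l) y / (mi_fact l)%:R|.
(* The factor m^p converts the Euclidean norm of the Lipschitz condition to the sup norm; [K] bounds
   the nonlinear terms. *)
exists (M * m%:R `^ p + K) => x Sx xy1.
set z := x - y in xy1 *; set N := `|z| `^ (1 + alpha).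
have [_] := HM j (ltnW jk) x y Sx Sy; rewrite /jet_remainder fj0// sub0r -/z.
rewrite normrN (bigID (fun l : bmultinom m k.+1 => mdeg l == 1%N)) /=.
under eq_bigl => l.
  have -> : (mdeg (mnm_add j l) <= k)%N && (mdeg l == 1%N) = (mdeg l == 1%N).
    by rewrite mdegD; case: eqP => [->|]; rewrite ?andbF// addn1 jk.
  over.
rewrite (@sum_mdeg1 _ m k.+1 (fun l => f (mnm_add j l) y / (mi_fact l)%:R *
  mmap1 (fun i => z ord0 i) l)); last by rewrite ltnS (leq_ltn_trans _ jk).
rewrite (eq_bigr (fun i => f (mnm_add j (mnm1 i)) y * z ord0 i)); last first.
  by move=> i _; rewrite mi_fact1 divr1 mmap1U.
set L := \sum_i _; set B := \sum_(l | _) _ => HR.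
have hN : M * enorm z `^ p <= M * m%:R `^ p * N.
  rewrite -mulrA ler_pM2l//; apply: (@le_trans _ _ ((m%:R * `|z|) `^ p)).
    apply: ge0_ler_powR; rewrite ?nnegrE ?sqrtr_ge0 ?mulr_ge0 ?enorm_le//.
    by rewrite (le_trans _ p1)// addr_ge0// ltW.
  rewrite powRM// ler_wpM2l ?powR_ge0// powR_le_exp// ?normr_ge0//.
  by rewrite addr_gt0.
have hB : `|B| <= K * N.
  rewrite /K mulr_suml (le_trans (ler_norm_sum _ _ _))//.
  (* [K] sums over all [l], so the terms that do not occur in [B] are split off and dropped as
     nonnegative. *)
  rewrite [leRHS](bigID (fun l : bmultinom m k.+1 =>
    (mdeg (mnm_add j l) <= k)%N && (mdeg l != 1%N))) /=.
  rewrite -[leLHS]addr0 lerD//; last first.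
    by apply: sumr_ge0 => l _; rewrite mulr_ge0// powR_ge0.
  apply: ler_sum => l /andP[_ l1]; rewrite normrM.
  have [/eqP|l0] := eqVneq (mdeg l) 0%N.
    by rewrite mdeg_eq0 => /eqP ->; rewrite addm0 fj0// mul0r normr0 !mul0r.
  rewrite ler_wpM2l//.
  rewrite (le_trans (mmap1_norm_le _ _))// -powR_mulrn//.
  rewrite powR_le_exp ?normr_ge0// addr_gt0//=.
  apply: (@le_trans _ _ 2%:R); first by lra.
  by rewrite ler_nat; case: (mdeg l) l0 l1 => [|[]].
rewrite mulrDl; apply: le_trans (lerD (le_trans HR hN) hB).
by rewrite -[L in leLHS](addrK B) (le_trans (ler_normB _ _)).
Qed.


(** * Passage to tangent directions *)

Local Open Scope classical_set_scope.

(** Along the curve g(v + h w) in [S], the difference quotient [q h] tends to the tangent vector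
    [w *m 'J g v], while the bound divided by |h| is C |q h| |phi h|^alpha, which tends to 0. *)
Lemma tangent_annihilated (R : realType) n m (S : set 'rV[R]_m)
    (V : set 'rV[R]_n) (g : 'rV[R]_n -> 'rV[R]_m) v (a : 'rV[R]_m) C alpha :
  0 < alpha -> open V -> V v -> (forall u, V u -> S (g u)) ->
  differentiable g v ->
  (forall x, S x -> `|x - g v| <= 1 ->
    `|\sum_i a ord0 i * (x - g v) ord0 i| <= C * `|x - g v| `^ (1 + alpha)) ->
  'J g v *m a^T = 0.
Proof.
move=> a0 oV Vv gS dg bnd.
pose L (z : 'rV[R]_m) := \sum_i a ord0 i * z ord0 i.
suff LJ w : L (w *m 'J g v) = 0.
  apply/row_matrixP => r; rewrite row0 rowE mulmxA; apply/rowP => c.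
  rewrite ord1 [RHS]mxE -[RHS](LJ (delta_mx 0 r)) mxE.
  by apply: eq_bigr => i _; rewrite [a^T _ _]mxE mulrC.
pose phi (h : R) : 'rV[R]_m := g (h *: w + v) - g v.
pose q (h : R) : 'rV[R]_m := h^-1 *: phi h.
have qD : q h @[h --> (0 : R)^'] --> w *m 'J g v.
  by rewrite -deriveEjacobian//; exact: (diff_derivable dg).
have Lc : continuous L.
  apply: (continuous_big add_continuous) => i _ z.
  by apply: continuousM; [exact: cst_continuous|exact: coord_continuous].
have tov : h *: w + v @[h --> (0 : R)^'] --> 0 *: w + v.
  apply: cvgD; last exact: cvg_cst.
  by apply: cvgZr_tmp; exact: nbhs_dnbhs.
rewrite scale0r add0r in tov.
have phi0 : phi h @[h --> (0 : R)^'] --> (0 : 'rV[R]_m).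
  rewrite -(subrr (g v)).
  apply: cvgB; last exact: cvg_cst.
  by apply: continuous_cvg; [exact: differentiable_continuous|].
have phi_le (e : R) : 0 < e -> \forall h \near (0 : R)^', `|phi h| <= e.
  move=> e0; move/cvgrPdist_le: phi0 => /(_ e e0).
  by apply: filterS => h; rewrite sub0r normrN.
have phia0 : `|phi h| `^ alpha @[h --> (0 : R)^'] --> (0 : R).
  apply/cvgrPdist_le => e e0; near=> h.
  rewrite sub0r normrN ger0_norm ?powR_ge0//.
  (* Writing e as (e^(1/alpha))^alpha reduces the claim to |phi h| <= e^(1/alpha). *)
  rewrite -[leRHS](powRr1 (ltW e0)) -(mulVf (lt0r_neq0 a0)) powRrM.
  apply: ge0_ler_powR; rewrite ?nnegrE ?powR_ge0// ?(ltW a0)//.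
  by near: h; apply: phi_le; exact: powR_gt0.
have lim0 : C * `|q h| * `|phi h| `^ alpha @[h --> (0 : R)^'] -->
    C * `|w *m 'J g v| * 0.
  apply: cvgM phia0; apply: cvgM; [exact: cvg_cst|exact: cvg_norm].
apply/eqP; rewrite -normr_le0 -[leRHS](mulr0 (C * `|w *m 'J g v|)).
have LqD := continuous_cvg _ (Lc _) qD.
have nLqD : `|L (q h)| @[h --> (0 : R)^'] --> `|L (w *m 'J g v)|.
  by apply: cvg_norm; exact: LqD.
apply: ler_cvg_to nLqD lim0 _; near=> h.
have h0 : h != 0 by near: h; exact: nbhs_dnbhs_neq.
have -> : L (q h) = h^-1 * L (phi h).
  by rewrite /L mulr_sumr; apply: eq_bigr => i _; rewrite mxE mulrCA.
have Sg : S (g (h *: w + v)).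
  by apply: gS; near: h; apply: tov; exact: open_nbhs_nbhs.
have phi1 : `|phi h| <= 1 by near: h; exact: phi_le.
rewrite /q normrM normrZ mulrCA -!mulrA ler_wpM2l//.
rewrite -[X in _ * (X * _)]powRr1// -powRD ?bnd//.
by rewrite gt_eqF// addr_gt0.
Unshelve. all: by end_near. Qed.

Local Close Scope classical_set_scope.

(** The normal depends only on the surface at [y], so one [nu] and one [p] serve every [j] and every
    Clifford coordinate, and the coordinatewise relations combine into one in the algebra. *)
Lemma normal_derivatives (R : realType) m k (alpha lam : R) (S : set 'rV[R]_m)
    (f : multinom m -> 'rV[R]_m -> clifford R m) s y :
  (0 < m)%N -> 0 < alpha <= 1 -> lyapunov_surface lam S -> cl_Lip k alpha S f ->
  (s < k)%N -> (forall j, mdeg j = s -> forall x, S x -> f j x = 0) -> S y ->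
  exists (nu : 'I_m -> R) p, nu p = 1 /\ forall j i, mdeg j = s ->
    f (mnm_add j (mnm1 i)) y = nu i *: f (mnm_add j (mnm1 p)) y.
Proof.
move=> m0 a01 [_ HS] hf sk fs0 Sy; have a0 : 0 < alpha by case/andP: a01.
have [U [V [g [h [Uy [[_ oV] [gV _ gsurj] _ _ _] [imm _]]]]]] := HS y Sy.
have [v Vv gv] := gsurj y (conj Sy Uy).
have [dg rJ] := imm v Vv.
have [nu [p [nup Hnu]]] := row_free_normal m0 rJ.
exists (nu ord0), p; split=> // j i js; apply/cliffordP => A.
rewrite cl_coordZ; pose a : 'rV[R]_m := \row_i f (mnm_add j (mnm1 i)) y A.
have fjA0 x : S x -> f j x A = 0 by move=> Sx; rewrite fs0// cl_coord0.
have jk : (mdeg j < k)%N by rewrite js.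
have [C HC] := jet_linear_part_le a01 (hf A) jk fjA0 Sy.
have /Hnu/(_ i) : 'J g v *m a^T = 0.
  apply: (tangent_annihilated (S := S) (C := C) a0 oV Vv) => //.
    by move=> u /gV[].
  move=> x Sx; rewrite gv => xy1; apply: le_trans (HC x Sx xy1).
  by under eq_bigr do rewrite mxE.
by rewrite !mxE.
Qed.

(** * The equation for the common factor *)

Lemma cl_mi1 (R : comNzRingType) m (i : 'I_m) : cl_mi R (mnm1 i) = cl_gen R i.
Proof.
rewrite /cl_mi; case: pickP => [l|/(_ i)]; rewrite mnm1E ?eqxx//.
by rewrite eqb1 => /eqP ->.
Qed.

Lemma even_sum_monomial_eq0 (R : realType) m (nu : 'I_m -> R) p s b
    (c : clifford R m) : nu p = 1 -> ~~ odd s -> (s < b)%N ->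
  \sum_(j : bmultinom m b | (mdeg j == s) && mi_even j) mmap1 nu j *: c = 0 ->
  c = 0.
Proof.
move=> nup evs sb; rewrite -scaler_suml => /eqP; rewrite scaler_eq0.
by rewrite gt_eqF ?(mmap1_even_sum_gt0 nup)//= => /eqP.
Qed.

(** Since nu^(j + l) = nu^j nu^l, the double sum factors as P (w c), with P the positive sum of even
    monomials of degree s - 1 and w the Clifford vector of [nu]. Cancelling P and then w gives c =
    0. *)
Lemma odd_sum_monomial_eq0 (R : realType) m (nu : 'I_m -> R) p s b
    (c : clifford R m) : nu p = 1 -> odd s -> (s < b)%N ->
  \sum_(jl : bmultinom m b * bmultinom m b |
      [&& mdeg (mnm_add jl.1 jl.2) == s, mi_even jl.1 & mdeg jl.2 == 1%N])
    cl_mi R jl.2 * (mmap1 nu (mnm_add jl.1 jl.2) *: c) = 0 ->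
  c = 0.
Proof.
case: s => // s nup /= evs sb.
pose w := \sum_i nu i *: cl_gen R i.
rewrite (eq_bigl (fun jl : bmultinom m b * bmultinom m b =>
   ((mdeg jl.1 == s) && mi_even jl.1) && (mdeg jl.2 == 1%N))); last first.
  move=> jl /=; rewrite mdegD -andbA [in LHS]andbCA [in RHS]andbCA.
  congr (_ && _).
  by case: (mdeg jl.2 =P 1%N) => [->|]; rewrite ?andbF// addn1 eqSS.
rewrite -(pair_big (fun j : bmultinom m b => (mdeg j == s) && mi_even j)
  (fun l : bmultinom m b => mdeg l == 1%N)
  (fun j l => cl_mi R l * (mmap1 nu (mnm_add j l) *: c))) /=.
rewrite (eq_bigr (fun j : bmultinom m b => mmap1 nu j *: (w * c))).
  move/(even_sum_monomial_eq0 nup evs (ltnW sb)).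
  by apply: (cl_vec_reg (p := p)); rewrite nup oner_eq0.
move=> j _; rewrite (@sum_mdeg1 _ m b (fun l =>
  cl_mi R l * (mmap1 nu (mnm_add j l) *: c))); last exact: leq_trans sb.
rewrite /w mulr_suml scaler_sumr; apply: eq_bigr => i _.
rewrite cl_mi1 commr_mmap1_M; last by move=> *; exact: mulrC.
by rewrite mmap1U -scalerAr -scalerAl scalerA.
Qed.

(** * Induction on the order *)

Unset Implicit Arguments.

Theorem theorem3p2 (R : realType) (m : nat) (hm : (2 <= m)%N)
    (k : nat) (alpha : R) (halpha : 0 < alpha < 1)
    (Omega : set 'rV[R]_m) (hOmega : jordan_domain Omega)
    (lam : R) (hlam : 0 < lam <= 1)
    (hGamma : lyapunov_surface lam (boundary Omega))
    (f : multinom m -> 'rV[R]_m -> clifford R m)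
    (hf : cl_Lip k alpha (boundary Omega) f)
    (hf0 : forall x, boundary Omega x -> f mnm0 x = 0)
    (heven : forall s : nat, (1 <= s <= k)%N -> ~~ odd s ->
       forall x, boundary Omega x ->
         \sum_(j : bmultinom m s.+1 | (mdeg j == s) && mi_even j) f j x = 0)
    (hodd : forall s : nat, (1 <= s <= k)%N -> odd s ->
       forall x, boundary Omega x ->
         \sum_(jl : bmultinom m s.+1 * bmultinom m s.+1 |
                 [&& mdeg (mnm_add jl.1 jl.2) == s, mi_even jl.1 &
                     mdeg jl.2 == 1%N])
           cl_mi R jl.2 * f (mnm_add jl.1 jl.2) x = 0) :
  forall j : multinom m, (mdeg j <= k)%N ->
    forall x, boundary Omega x -> f j x = 0.
Proof.
suff H s : (s <= k)%N -> forall j, mdeg j = s ->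
    forall x, boundary Omega x -> f j x = 0 by move=> j jk; exact: (H _ jk).
have m0 : (0 < m)%N by apply: leq_trans hm.
have a01 : 0 < alpha <= 1 by case/andP: halpha => -> /ltW.
elim: s => [_ j /eqP|s IH sk j js x Sx].
  by rewrite mdeg_eq0 => /eqP ->.
have [nu [p [nup Hnu]]] :=
  normal_derivatives m0 a01 hGamma hf sk (IH (ltnW sk)) Sx.
have fE := homogeneous_monomial (F := f^~ x)
  (fun j i js => Hnu j i (succn_inj js)).
(* All members of order s + 1 at [x] are now multiples of the single [c], the one at the index (s +
   1) e_p. *)
rewrite (fE j js); set c := f _ x in fE *.
suff -> : c = 0 by rewrite scaler0.
have [os|es] := boolP (odd s.+1).
  apply: (odd_sum_monomial_eq0 nup os (ltnSn _)).
  rewrite -[RHS](hodd s.+1 _ os x Sx)//.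
  by apply: eq_bigr => jl /and3P[/eqP jls _ _]; rewrite fE.
apply: (even_sum_monomial_eq0 nup es (ltnSn _)).
rewrite -[RHS](heven s.+1 _ es x Sx)//.
by apply: eq_bigr => jl /andP[/eqP jls _]; rewrite fE.
Qed.
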